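(* Let $\mathcal{M}$ be an oriented matroid of rank $r$ on $n$ elements, and let $X,Y$ be cocircuits of $\mathcal{M}$ with $X\neq -Y$. Then $$d_{\mathcal{M}}(X,Y)\le n-r+1+\sum_{k=2}^{|X^0\setminus Y^0|-1}\left(\left\lfloor\frac{n-r-k}{2}\right\rfloor+1\right)$$ (an empty sum being $0$). In particular, if $r\ge 4$ and $n-r\ge 2$, then $$\operatorname{diam}(G^*(\mathcal{M}))\le n-r+1+\sum_{k=2}^{\min(r-2,\,n-r)}\left(\left\lfloor\frac{n-r-k}{2}\right\rfloor+1\right).$$
   Context: Sign vectors: for a finite set $E$ and $X\in\{+,-,0\}^E$, write $X^+=\{e:X_e=+\}$, $X^-=\{e:X_e=-\}$, $X^0=\{e:X_e=0\}$, $\operatorname{supp}(X)=X^+\cup X^-$, and $-X$ for the componentwise negation. For sign vectors $X,Y$, the separating set is $S(X,Y)=(X^+\cap Y^-)\cup(X^-\cap Y^+)$, and the composition $X\circ Y$ is given by $(X\circ Y)_e=X_e$ if $X_e\neq 0$ and $(X\circ Y)_e=Y_e$ otherwise. An oriented matroid $\mathcal{M}=(E,\mathcal{C}^* )$ is a finite set $E$ together with a set $\mathcal{C}^*\subseteq\{+,-,0\}^E$ of (signed) cocircuits satisfying: (CC0) $\mathbf{0}\notin\mathcal{C}^*$; (CC1) $X\in\mathcal{C}^*\Rightarrow -X\in\mathcal{C}^*$; (CC2) if $X,Y\in\mathcal{C}^*$ and $\operatorname{supp}(X)\subseteq\operatorname{supp}(Y)$ then $X=\pm Y$; (CC3) if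 $X,Y\in\mathcal{C}^*$, $X\neq -Y$ and $e\in S(X,Y)$, then there is $Z\in\mathcal{C}^*$ with $Z^+\subseteq (X^+\cup Y^+)\setminus\{e\}$ and $Z^-\subseteq (X^-\cup Y^-)\setminus\{e\}$. The covectors of $\mathcal{M}$ are $\mathbf{0}$ together with all compositions $X^1\circ\cdots\circ X^k$ ($k\ge 1$) of cocircuits, partially ordered componentwise by $0<+$ and $0<-$ ($+,-$ incomparable). The rank $r$ of $\mathcal{M}$ is the largest $k$ such that there is a chain $\mathbf{0}=V_0<V_1<\cdots<V_k$ of covectors. The cocircuit graph $G^*(\mathcal{M})$ has the cocircuits as vertices, with distinct cocircuits $X,Y$ adjacent iff $|X^0\cap Y^0|\ge r-2$ and $S(X,Y)=\emptyset$. $d_{\mathcal{M}}(X,Y)$ denotes graph distance in $G^*(\mathcal{M})$ and $\operatorname{diam}(G^*(\mathcal{M}))$ its maximum over pairs of cocircuits. *)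

(* Defs.v *)
(* Oriented matroids given by their signed cocircuits. *)
From HB Require Import structures.
From mathcomp Require Import all_boot all_order all_algebra.
Set Implicit Arguments. Unset Strict Implicit. Unset Printing Implicit Defensive.

Inductive sign := Zero | Plus | Minus.

Definition sign_to (s : sign) : option bool :=
  match s with Zero => None | Plus => Some true | Minus => Some false end.
Definition sign_of (o : option bool) : sign :=
  match o with None => Zero | Some true => Plus | Some false => Minus end.
Lemma sign_toK : cancel sign_to sign_of. Proof. by case. Qed.
HB.instance Definition _ := Finite.copy sign (can_type sign_toK).

Definition sopp (s : sign) : sign :=
  match s with Zero => Zero | Plus => Minus | Minus => Plus end.

Section SignVectors.
Variable E : finType.
Notation sv := {ffun E -> sign}.

Definition sv0 : sv := [ffun => Zero].
Definition svopp (X : sv) : sv := [ffun e => sopp (X e)].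
Definition svplus (X : sv) : {set E} := [set e | X e == Plus].
Definition svminus (X : sv) : {set E} := [set e | X e == Minus].
Definition svzero (X : sv) : {set E} := [set e | X e == Zero].
Definition svsupp (X : sv) : {set E} := svplus X :|: svminus X.
Definition svsep (X Y : sv) : {set E} :=
  (svplus X :&: svminus Y) :|: (svminus X :&: svplus Y).
Definition svcomp (X Y : sv) : sv :=
  [ffun e => if X e != Zero then X e else Y e].

Definition is_oriented_matroid (C : {set sv}) : Prop :=
  [/\ sv0 \notin C,
      (forall X, X \in C -> svopp X \in C),
      (forall X Y, X \in C -> Y \in C -> svsupp X \subset svsupp Y ->
         X = Y \/ X = svopp Y) &
      (forall X Y e, X \in C -> Y \in C -> X != svopp Y -> e \in svsep X Y ->
         exists2 Z, Z \in C &
           svplus Z \subset (svplus X :|: svplus Y) :\ e /\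
           svminus Z \subset (svminus X :|: svminus Y) :\ e)].

Definition is_covector (C : {set sv}) (V : sv) : Prop :=
  exists s : seq sv, {subset s <= C} /\ V = foldr svcomp sv0 s.

Definition svle (V W : sv) : bool := [forall e, (V e == Zero) || (V e == W e)].
Definition svlt (V W : sv) : bool := (V != W) && svle V W.

Definition has_chain (C : {set sv}) (k : nat) : Prop :=
  exists s : seq sv, size s = k /\ (forall V, V \in s -> is_covector C V) /\
                     path svlt sv0 s.

Definition has_rank (C : {set sv}) (r : nat) : Prop :=
  has_chain C r /\ (forall k, has_chain C k -> k <= r).

Definition coc_adj (C : {set sv}) (r : nat) : rel sv := fun X Y =>
  [&& X \in C, Y \in C, X != Y,
      (r - 2 <= #|svzero X :&: svzero Y|)%N & svsep X Y == set0].

Definition coc_dist_le (C : {set sv}) (r : nat) (X Y : sv) (m : int) : Prop :=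
  exists p : seq sv, path (coc_adj C r) X p /\ last X p = Y /\
                     ((size p)%:Z <= m)%R.

Definition coc_diam_le (C : {set sv}) (r : nat) (m : int) : Prop :=
  forall X Y, X \in C -> Y \in C -> coc_dist_le C r X Y m.

End SignVectors.

(* Main.v *)
(* Write N = n - r. On the circle carried by a coline, the cocircuit graph
   distance from X to Z is at most 1 + |S(X,Z)|. Let t be the corank of
   X^0 /\ Y^0 in the hyperplane X^0; we induct on t.
   If t >= 3, move along a coline in X^0 that spans X^0 /\ Y^0 but is not inside
   Y^0. Going around in the two directions and stopping at the first cocircuit
   that meets Y^0 \ X^0, one crosses disjoint sets of elements outside
   X^0 \/ Y^0, and there are at most N + 1 - t of those; the shorter way costs at
   most (N + 1 - t)/2 + 1 steps and lowers t.
   If t = 2, X and Y are opposite corners of a quadrilateral whose sides lie on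
   four colines. Its boundary consists of two paths from X to Y, and each of the
   remaining N - 1 elements crosses it at most twice, so one of the two paths has
   length at most N + 1. *)
Require Import Defs.
From mathcomp Require Import all_boot all_order all_algebra.
From mathcomp Require Import zify.
Import GRing.Theory Num.Theory.

Set Implicit Arguments.
Unset Strict Implicit.
Unset Printing Implicit Defensive.
Local Open Scope nat_scope.

(** * Signs and auxiliary inequalities *)

Lemma soppK : involutive sopp. Proof. by case. Qed.

Lemma sopp_neq (s : sign) : s <> Zero -> sopp s <> s. Proof. by case: s. Qed.

Lemma sopp_neq0 (s : sign) : s <> Zero -> sopp s <> Zero. Proof. by case: s. Qed.

Lemma sign_eq_or_opp (s t : sign) :
  s <> Zero -> t <> Zero -> s = t \/ s = sopp t.
Proof. by case: s; case: t => //; [left | right | right | left]. Qed.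

Lemma leq_half_of_sum m n k : m + n <= k -> k./2 < m -> n <= k./2.
Proof. lia. Qed.

Lemma two_path_arith s1 s2 s3 s4 o r n :
  s1 + s2 + (s3 + s4) <= o * 2 -> r.+1 + o = n ->
  (n - r).+1 < s1.+1 + s2.+1 -> s3.+1 + s4.+1 <= (n - r).+1.
Proof. lia. Qed.

Lemma outside_arith o r s n : o + (r.-1 + s.+3) <= n -> o <= n - r - s.+2.
Proof. lia. Qed.

Lemma diff_arith d z z' r n : r.-1 <= z -> 0 < r -> z + z' = n -> d <= z' -> d <= (n - r).+1.
Proof. lia. Qed.

Lemma antipodal_arith s t r n : s + t + r <= n -> s.+1 + t.+1 <= (n - r).+2.
Proof. lia. Qed.

(** * Zero sets and elementwise forms of the cocircuit axioms *)

Section OrientedMatroid.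

Variables (E : finType) (C : {set {ffun E -> sign}}).
Notation sv := {ffun E -> sign}.

Lemma svoppE (X : sv) e : svopp X e = sopp (X e).
Proof. by rewrite ffunE. Qed.

Lemma svoppK : involutive (@svopp E).
Proof. by move=> X; apply/ffunP => e; rewrite !svoppE soppK. Qed.

Lemma in_svzero (X : sv) e : (e \in svzero X) = (X e == Zero).
Proof. by rewrite inE. Qed.

Lemma svzero_opp (X : sv) : svzero (svopp X) = svzero X.
Proof. by apply/setP => e; rewrite !inE svoppE; case: (X e). Qed.

Lemma svsuppE (X : sv) : svsupp X = ~: svzero X.
Proof. by apply/setP => e; rewrite !inE; case: (X e). Qed.

Lemma in_svsep (X Y : sv) e :
  (e \in svsep X Y) = (X e != Zero) && (Y e == sopp (X e)).
Proof. by rewrite !inE; case: (X e); case: (Y e). Qed.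

Hypothesis OM : is_oriented_matroid C.

Lemma cocircuitN X : X \in C -> svopp X \in C.
Proof. by case: OM => _ h _ _; apply: h. Qed.

Lemma cocircuit_neq0 X : X \in C -> exists e, X e <> Zero.
Proof.
case: OM => h0 _ _ _ XC; have [e /eqP he|h] := pickP (fun e => X e != Zero).
  by exists e.
case/negP: h0; suff -> : sv0 E = X by [].
by apply/ffunP => e; rewrite ffunE; move/negbFE/eqP: (h e) => ->.
Qed.

(** Zero sets of cocircuits are the hyperplanes of the underlying matroid; by (CC2) no hyperplane
    properly contains another. *)
Lemma cocircuit_minimal X Y : X \in C -> Y \in C ->
  svzero X \subset svzero Y -> Y = X \/ Y = svopp X.
Proof.
case: OM => _ _ h _ XC YC sXY.
by apply: h => //; rewrite !svsuppE setCS.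
Qed.

Lemma cocircuit_elim X Y e : X \in C -> Y \in C -> X <> svopp Y ->
  X e <> Zero -> Y e = sopp (X e) ->
  exists2 Z, Z \in C & Z e = Zero /\
    forall f, [\/ Z f = Zero, Z f = X f | Z f = Y f].
Proof.
case: OM => _ _ _ h XC YC /eqP nXY /eqP Xe /eqP Ye.
have [|Z ZC [/subsetP sp /subsetP sm]] := h X Y e XC YC nXY.
  by rewrite in_svsep Xe.
exists Z => //; split=> [|f].
  have := sp e; have := sm e; rewrite !inE eqxx /=.
  by case: (Z e) => // h1 h2; [have := h2 isT | have := h1 isT].
have := sp f; have := sm f; rewrite !inE.
case: (Z f) => [_ _|_ /(_ isT)|/(_ isT) + _]; first by constructor 1.
  by case/andP=> _ /orP[/eqP->|/eqP->]; [constructor 2 | constructor 3].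
by case/andP=> _ /orP[/eqP->|/eqP->]; [constructor 2 | constructor 3].
Qed.

(** Unsigned elimination: [Y] may be negated to disagree with [X] at [e], and [b] ensures that the
    two are not opposite. *)
Lemma cocircuit_weak_elim X Y e b : X \in C -> Y \in C ->
  X e <> Zero -> Y e <> Zero -> X b <> Zero -> Y b = Zero ->
  exists2 Z, Z \in C & Z e = Zero /\
    (forall f, X f = Zero -> Y f = Zero -> Z f = Zero).
Proof.
move=> XC YC Xe Ye Xb Yb.
have [Y' [Y'C Y'e Y'0]] : exists Y', [/\ Y' \in C, Y' e = sopp (X e) &
    forall f, (Y' f = Zero) <-> (Y f = Zero)].
  have [eYX|eYX] := sign_eq_or_opp Ye Xe; last by exists Y.
  exists (svopp Y); split; [exact: cocircuitN| by rewrite svoppE eYX|].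
  by move=> f; rewrite svoppE; case: (Y f).
have [|Z ZC [Ze hZ]] := cocircuit_elim XC Y'C _ Xe Y'e.
  move=> eXY; apply: Xb; rewrite eXY svoppE.
  by have [_ ->] := Y'0 b.
exists Z => //; split=> // f Xf Yf.
by case: (hZ f) => -> //; apply/Y'0.
Qed.

(* Standard minimality argument for matroid circuits: when the eliminated
   cocircuit misses [b], two further eliminations inside strictly smaller
   unions of supports recover it. *)
Lemma cocircuit_strong_elim X Y e b : X \in C -> Y \in C ->
  X e <> Zero -> Y e <> Zero -> X b <> Zero -> Y b = Zero ->
  exists2 Z, Z \in C & [/\ Z e = Zero, Z b <> Zero &
    (forall f, X f = Zero -> Y f = Zero -> Z f = Zero)].
Proof.
have [m] := ubnP #|svsupp X :|: svsupp Y|.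
elim: m X Y e b => // m IH X Y e b ltm XC YC Xe Ye Xb Yb.
have [Z ZC [Ze hZ]] := cocircuit_weak_elim XC YC Xe Ye Xb Yb.
have [Zb|/eqP Zb] := eqVneq (Z b) Zero; last by exists Z.
have smaller (U V : sv) g : U g = Zero -> V g = Zero ->
    (X g <> Zero \/ Y g <> Zero) ->
    (forall f, X f = Zero -> Y f = Zero -> U f = Zero /\ V f = Zero) ->
    #|svsupp U :|: svsupp V| < m.
  move=> Ug Vg XYg sub; apply: leq_trans (_ : _ <= #|svsupp X :|: svsupp Y|) _; last by [].
  apply/proper_card/properP; split.
    apply/subsetP => f; rewrite !svsuppE !inE -!negb_and; apply: contra.
    by case/andP=> /eqP Xf /eqP Yf; have [-> ->] := sub f Xf Yf.
  exists g; rewrite !svsuppE !inE; last by rewrite Ug Vg.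
  by case: XYg => /eqP -> //; rewrite orbT.
(* Otherwise [X^0] lies in [Z^0], so [Z] is [X] or its opposite; [e] excludes the first and [b] the
   second. *)
have [c Xc Zc] : exists2 c, X c = Zero & Z c <> Zero.
  have [c /andP[/eqP Xc /eqP Zc]|h] :=
    pickP (fun c => (X c == Zero) && (Z c != Zero)); first by exists c.
  case: (@cocircuit_minimal X Z) => //.
  - apply/subsetP => f; rewrite !in_svzero => Xf.
    by have := h f; rewrite Xf /= => /negbFE.
  - by move=> eZ; case: Xe; rewrite -eZ.
  - by move=> eZ; case: Xb; rewrite -[X]svoppK -eZ svoppE Zb.
have Yc : Y c <> Zero by move=> Yc; apply: Zc; apply: hZ.
(* Both recursive calls have a smaller union of supports: [Y] and [Z] vanish at [b], then [X] and
   [W] vanish at [c]. *)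
have [|W WC [Wc We hW]] := IH Y Z c e _ YC ZC Yc Zc Ye Ze.
  apply: (smaller _ _ b) => //; first by left.
  by move=> f Xf Yf; split=> //; apply: hZ.
have [||V VC [Ve Vb hV]] := IH X W e b _ XC WC Xe We Xb.
- apply: (smaller _ _ c) => //; first by right.
  by move=> f Xf Yf; split=> //; apply: hW => //; apply: hZ.
- exact: hW.
exists V => //; split=> // f Xf Yf.
by apply: hV => //; apply: hW => //; apply: hZ.
Qed.

(** * The underlying matroid *)

(** Independence in the underlying matroid: no element lies in the closure of the others, a closure
    being an intersection of hyperplanes. *)
Definition indep (A : {set E}) : Prop :=
  forall a, a \in A ->
    exists2 X, X \in C & X a <> Zero /\ A :\ a \subset svzero X.

Lemma indep0 : indep set0. Proof. by move=> a; rewrite inE. Qed.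

Lemma indepS (A B : {set E}) : A \subset B -> indep B -> indep A.
Proof.
move=> /subsetP sAB iB a aA; have [X XC [Xa hX]] := iB a (sAB a aA).
exists X => //; split=> //; apply: subset_trans hX.
by apply/setSD/subsetP.
Qed.

(** [X] itself isolates [f]. For [a] in [A], a witness that is nonzero at [f] is corrected by
    eliminating [f] against [X], which vanishes at [a]. *)
Lemma indepU1 (A : {set E}) X f : indep A -> X \in C -> A \subset svzero X ->
  X f <> Zero -> indep (f |: A).
Proof.
move=> iA XC /subsetP AX Xf; have fA : f \notin A.
  by apply/negP => /AX; rewrite in_svzero => /eqP.
move=> a; rewrite in_setU1 => /predU1P[->|aA].
  by exists X => //; split=> //; rewrite setU1K //; apply/subsetP.
have Xa : X a = Zero by apply/eqP; rewrite -in_svzero AX.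
have [Y YC [Ya /subsetP hY]] := iA a aA.
have red (W : sv) : W f = Zero -> (forall g, Y g = Zero -> X g = Zero -> W g = Zero) ->
    (f |: A) :\ a \subset svzero W.
  move=> Wf hW; apply/subsetP => g; rewrite !inE => /andP[ga /predU1P[->|gA]].
    by rewrite Wf.
  apply/eqP/hW; first by apply/eqP; rewrite -in_svzero hY // !inE ga.
  by apply/eqP; rewrite -in_svzero AX.
have [Yf|/eqP Yf] := eqVneq (Y f) Zero.
  by exists Y => //; split=> //; apply: red.
have [Z ZC [Zf Za hZ]] := cocircuit_strong_elim YC XC Yf Xf Ya Xa.
by exists Z => //; split=> //; apply: red.
Qed.

(* Gaussian elimination on a family of cocircuits that is diagonal on [B]:
   each element of [A] costs at most one member of the family. *)
Lemma exists_cocircuit_vanishing (A B : {set E}) : indep B -> #|A| < #|B| ->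
  exists2 X, X \in C & A \subset svzero X /\ exists2 b, b \in B & X b <> Zero.
Proof.
move=> iB; pose diag (D B' : {set E}) := forall b, b \in B' -> exists2 X, X \in C &
  [/\ X b <> Zero, B' :\ b \subset svzero X & D \subset svzero X].
suff main : forall k (D A' B' : {set E}), #|A'| = k -> B' \subset B ->
    diag D B' -> k < #|B'| ->
    exists2 X, X \in C & (D :|: A') \subset svzero X /\ exists2 b, b \in B & X b <> Zero.
  move=> ltAB; have [|X XC [sX hX]] := main #|A| set0 A B (erefl _) (subxx _) _ ltAB.
    move=> b bB; have [X XC [Xb hX]] := iB b bB; exists X => //.
    by split=> //; apply: sub0set.
  by exists X => //; split=> //; rewrite set0U in sX.
elim=> [|k IH] D A' B' cA sB dB ltk.
  have [b bB'] := card_gt0P ltk; have [X XC [Xb _ DX]] := dB b bB'.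
  exists X => //; split; last by exists b => //; apply: (subsetP sB).
  by rewrite (cards0_eq cA) setU0.
have [a aA] : exists a, a \in A' by apply/card_gt0P; rewrite cA.
have cAa : #|A' :\ a| = k by move: cA; rewrite (cardsD1 a) aA => -[].
have -> : D :|: A' = (a |: D) :|: (A' :\ a).
  by rewrite -setUA (setUCA [set a]) setD1K.
suff [B'' [sB'' dB'' ltB'']] : exists B'' : {set E},
    [/\ B'' \subset B', diag (a |: D) B'' & k < #|B''|].
  by apply: (IH _ _ B'') => //; apply: subset_trans sB.
have subD (X : sv) : X a = Zero -> D \subset svzero X -> a |: D \subset svzero X.
  by move=> Xa DX; rewrite subUset sub1set in_svzero Xa eqxx.
(* Look for a pivot [p] whose cocircuit is nonzero at [a]. Without one the family already vanishes
   at [a]; otherwise [p] is dropped and its cocircuit clears [a] from the others. *)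
have [/existsP[p /andP[pB /existsP[P /and4P[PC Pa sP DP]]]]|hno] := boolP
  [exists p, (p \in B') && [exists P, [&& P \in C, (P a != Zero) && (P p != Zero),
     B' :\ p \subset svzero P & D \subset svzero P]]]; last first.
  exists B'; split=> //; last by apply: ltnW.
  move=> b bB'; have [X XC [Xb sX DX]] := dB b bB'; exists X => //; split=> //.
  apply: subD => //; apply/eqP; move/existsPn: hno => /(_ b).
  rewrite bB' /= => /existsPn/(_ X); rewrite XC sX DX /= andbT.
  by move/eqP: Xb => ->; rewrite andbT negbK.
case/andP: Pa => /eqP Pa /eqP Pp.
exists (B' :\ p); split; [exact: subsetDl| |by move: ltk; rewrite (cardsD1 p) pB].
move=> b; rewrite !inE => /andP[bp bB'].
have [X XC [Xb sX DX]] := dB b bB'.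
have Pb : P b = Zero.
  by apply/eqP; rewrite -in_svzero; apply: (subsetP sP); rewrite !inE bp.
have [Xa|/eqP Xa] := eqVneq (X a) Zero.
  exists X => //; split=> //; last exact: subD.
  by apply: subset_trans sX; apply/setSD/subsetDl.
have [Z ZC [Za Zb hZ]] := cocircuit_strong_elim XC PC Xa Pa Xb Pb.
exists Z => //; split=> //.
  apply/subsetP => g; rewrite !inE => /and3P[gb gp gB']; apply/eqP/hZ.
    by apply/eqP; rewrite -in_svzero; apply: (subsetP sX); rewrite !inE gb.
  by apply/eqP; rewrite -in_svzero; apply: (subsetP sP); rewrite !inE gp.
apply: subD => //; apply/subsetP => g gD; rewrite in_svzero; apply/eqP/hZ.
  by apply/eqP; rewrite -in_svzero (subsetP DX).
by apply/eqP; rewrite -in_svzero (subsetP DP).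
Qed.

Lemma indep_augment (A B : {set E}) : indep A -> indep B -> #|A| < #|B| ->
  exists b, [/\ b \in B, b \notin A & indep (b |: A)].
Proof.
move=> iA iB ltAB; have [X XC [AX [b bB Xb]]] := exists_cocircuit_vanishing iB ltAB.
exists b; split=> //; last exact: indepU1 XC AX Xb.
by apply/negP => /(subsetP AX); rewrite in_svzero => /eqP.
Qed.

Lemma indep_extend (A B D : {set E}) m : indep A -> indep B -> A \subset D -> B \subset D ->
  #|A| <= m -> m <= #|B| -> exists A', [/\ indep A', A \subset A', A' \subset D & #|A'| = m].
Proof.
move=> iA iB AD BD.
have [k] := ubnP (m - #|A|); elim: k A iA AD => // k IH A iA AD ltk leA leB.
have [eA|neA] := eqVneq #|A| m; first by exists A.
have ltA : #|A| < m by rewrite ltn_neqAle neA.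
have [b [bB bA ibA]] := indep_augment iA iB (leq_trans ltA leB).
have cb : #|b |: A| = #|A|.+1 by rewrite cardsU1 bA.
have [||||A' [iA' sA' A'D cA']] := IH (b |: A) ibA => //.
- by rewrite subUset sub1set (subsetP BD).
- lia.
- lia.
by exists A'; split=> //; apply: subset_trans sA'; apply: subsetUr.
Qed.

(** The second alternative says that [G] lies in the closure of [I]. *)
Lemma indep_dichotomy (I G : {set E}) : indep I ->
  (exists g, [/\ g \in G, g \notin I & indep (g |: I)]) \/
  (forall W, W \in C -> I \subset svzero W -> G \subset svzero W).
Proof.
move=> iI; have [/existsP[W /and3P[WC IW /subsetPn[g gG]]]|h] :=
  boolP [exists W, [&& W \in C, I \subset svzero W & ~~ (G \subset svzero W)]].
  move=> gW; left; exists g; split=> //; first by apply: contra gW => /(subsetP IW).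
  by apply: indepU1 WC IW _ => //; apply/eqP; rewrite -in_svzero.
right=> W WC IW; move/existsPn: h => /(_ W); by rewrite WC IW negbK.
Qed.

(** Greedy extension of [I] to a basis of [G]. *)
Lemma indep_maximal (I G : {set E}) : indep I -> I \subset G ->
  exists I', [/\ indep I', I \subset I', I' \subset G &
    forall W, W \in C -> I' \subset svzero W -> G \subset svzero W].
Proof.
have [k] := ubnP (#|G| - #|I|); elim: k I => // k IH I ltk iI IG.
have [[g [gG gI igI]]|h] := indep_dichotomy G iI; last by exists I.
have sg : g |: I \subset G by rewrite subUset sub1set gG.
have cg : #|g |: I| = #|I|.+1 by rewrite cardsU1 gI.
have le := subset_leq_card sg.
have [||I' [iI' sI' I'G hI']] := IH (g |: I) _ igI => //; first by lia.
by exists I'; split=> //; apply: subset_trans sI'; apply: subsetUr.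
Qed.

(** * Rank and chains of covectors *)

Lemma svcompA : associative (@svcomp E).
Proof. by move=> U V W; apply/ffunP => e; rewrite !ffunE; case: (U e). Qed.

Lemma svcomp0 (X : sv) : svcomp X (sv0 E) = X.
Proof. by apply/ffunP => e; rewrite !ffunE; case: (X e). Qed.

Lemma foldr_svcomp (Y : sv) s : foldr (@svcomp E) Y s = svcomp (foldr (@svcomp E) (sv0 E) s) Y.
Proof.
elim: s => [|X s IH] /=; last by rewrite IH svcompA.
by apply/ffunP => e; rewrite !ffunE.
Qed.

Lemma covector_comp V X : is_covector C V -> X \in C -> is_covector C (svcomp V X).
Proof.
case=> s [sC ->] XC; exists (rcons s X); split.
  by move=> Y; rewrite mem_rcons inE => /predU1P[->|/sC].
by rewrite -cats1 foldr_cat /= svcomp0 [RHS]foldr_svcomp.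
Qed.

(** The zero set of a composition is the intersection of those of its factors, so any factor nonzero
    at [a] will do. *)
Lemma covector_cocircuit W a : is_covector C W -> W a <> Zero ->
  exists2 X, X \in C & X a <> Zero /\ svzero W \subset svzero X.
Proof.
case=> s [sC ->]; elim: s sC => [_|X s IH sC] /=; first by rewrite ffunE.
rewrite ffunE; case: eqP => [Xa|Xa _] /=.
  case/IH=> [Y Ys|Y YC [Ya /subsetP hY]]; first by apply: sC; rewrite inE Ys orbT.
  exists Y => //; split=> //; apply/subsetP => e; rewrite in_svzero ffunE => he.
  by apply: hY; rewrite in_svzero; case: ifP he => // /negPf ->.
exists X; first by apply: sC; rewrite inE eqxx.
by split=> //; apply/subsetP => e; rewrite !in_svzero ffunE; case: ifP => // /negbFE.
Qed.

(** Composing [V] successively with the cocircuits that isolate the elements of [s] makes these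
    nonzero one at a time, so each step is strict. *)
Lemma chain_of_independent s V : uniq s -> is_covector C V ->
  (forall a, a \in s -> V a = Zero) ->
  (forall a, a \in s -> exists2 X, X \in C &
    X a <> Zero /\ forall b, b \in s -> b != a -> X b = Zero) ->
  exists t, [/\ size t = size s, forall W, W \in t -> is_covector C W & path (@svlt E) V t].
Proof.
elim: s V => [|a s IH] V /=; first by exists [::].
case/andP=> as_ us cV V0 hX.
have [|X XC [Xa hXa]] := hX a; first by rewrite inE eqxx.
have Va : V a = Zero by apply: V0; rewrite inE eqxx.
have cW := covector_comp cV XC.
have [||t [st ct pt]] := IH (svcomp V X) us cW.
- move=> b bs; rewrite ffunE V0 ?inE ?bs ?orbT //= hXa ?inE ?bs ?orbT //.
  by apply: contraNneq as_ => <-.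
- move=> b bs; have [|Y YC [Yb hY]] := hX b; first by rewrite inE bs orbT.
  by exists Y => //; split=> // c cs; apply: hY; rewrite inE cs orbT.
exists (svcomp V X :: t); split=> [|W|] /=; first by rewrite st.
  by rewrite inE => /predU1P[->|/ct].
rewrite pt andbT; apply/andP; split.
  by apply/eqP => /ffunP/(_ a); rewrite ffunE Va /= => /esym.
by apply/forallP => e; rewrite ffunE; case: (V e).
Qed.

(** Converse of the previous construction, built from the top of the chain: each strict step
    supplies an element that becomes nonzero, independent of those found above it. *)
Lemma independent_of_chain s V : path (@svlt E) V s ->
  (forall W, W \in s -> is_covector C W) ->
  exists A, [/\ indep A, A \subset svzero V & #|A| = size s].
Proof.
elim: s V => [|W s IH] V /=.
  by move=> _ _; exists set0; rewrite cards0 sub0set; split=> //; apply: indep0.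
case/andP=> /andP[nVW /forallP leVW] ps hs.
have [|A [iA AW cA]] := IH W ps.
  by move=> U Us; apply: hs; rewrite inE Us orbT.
have [a /andP[/eqP Va /eqP Wa]] : exists a, (V a == Zero) && (W a != Zero).
  apply/existsP; apply: contraNT nVW => /existsPn h.
  apply/eqP/ffunP => e; have := h e; have := leVW e.
  by case: (V e =P Zero) => [->|_ /eqP] //= _; rewrite negbK => /eqP.
have [|X XC [Xa sWX]] := covector_cocircuit _ Wa; first by apply: hs; rewrite inE eqxx.
have AX := subset_trans AW sWX.
exists (a |: A); split; first exact: indepU1 XC AX Xa.
  rewrite subUset sub1set in_svzero Va eqxx /=; apply/subsetP => e /(subsetP AW).
  by rewrite !in_svzero => /eqP We; have := leVW e; rewrite We orbb.
rewrite cardsU1 cA; case: (boolP (a \in A)) => // /(subsetP AW).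
by rewrite in_svzero => /eqP.
Qed.

Variable r : nat.
Hypothesis rankC : has_rank C r.

Lemma indep_card_le (A : {set E}) : indep A -> #|A| <= r.
Proof.
move=> iA; case: rankC => _; apply.
have [||||t [st ct pt]] := @chain_of_independent (enum A) (sv0 E).
- exact: enum_uniq.
- by exists [::].
- by move=> a _; rewrite ffunE.
- move=> a; rewrite mem_enum => aA; have [X XC [Xa /subsetP hX]] := iA a aA.
  exists X => //; split=> // b; rewrite mem_enum => bA ba.
  by apply/eqP; rewrite -in_svzero hX // !inE ba.
by exists t; rewrite st cardE.
Qed.

Lemma exists_basis : exists B : {set E}, indep B /\ #|B| = r.
Proof.
case: rankC => -[s [<- [cs ps]]] _.
by have [B [iB _ cB]] := independent_of_chain ps cs; exists B.
Qed.

Lemma small_set_cocircuit (A : {set E}) : #|A| < r ->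
  exists2 X, X \in C & A \subset svzero X.
Proof.
have [B [iB <-]] := exists_basis => ltA.
by have [X XC [AX _]] := exists_cocircuit_vanishing iB ltA; exists X.
Qed.

Lemma indep_vanishing_lt (A : {set E}) X : indep A -> X \in C ->
  A \subset svzero X -> #|A| < r.
Proof.
move=> iA XC AX; have [e Xe] := cocircuit_neq0 XC.
have := indep_card_le (indepU1 iA XC AX Xe); rewrite cardsU1.
by case: (boolP (e \in A)) => // /(subsetP AX); rewrite in_svzero => /eqP.
Qed.

Lemma cocircuit_outside X Z : X \in C -> Z \in C -> Z <> X -> Z <> svopp X ->
  exists2 g, X g = Zero & Z g <> Zero.
Proof.
move=> XC ZC n1 n2; have [/cocircuit_minimal|] := boolP (svzero X \subset svzero Z).
  by case/(_ XC ZC).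
by case/subsetPn=> g; rewrite !in_svzero => /eqP Xg /eqP; exists g.
Qed.

(** To enlarge [A], take a hyperplane through [A] and a point [f] off [X^0]. It differs from [X^0],
    so [X^0] has an element outside it. *)
Lemma hyperplane_indep X k : X \in C -> k < r ->
  exists A, [/\ indep A, A \subset svzero X & #|A| = k].
Proof.
move=> XC; elim: k => [_|k IH ltk].
  by exists set0; split; [exact: indep0|exact: sub0set|rewrite cards0].
have [A [iA AX cA]] := IH (ltnW ltk); have [f Xf] := cocircuit_neq0 XC.
have [|W WC] := @small_set_cocircuit (f |: A).
  by apply: leq_ltn_trans ltk; rewrite cardsU1 cA; case: (_ \notin _).
rewrite subUset sub1set in_svzero => /andP[/eqP Wf AW].
have [||g Xg Wg] := cocircuit_outside XC WC.
- by move=> eW; apply: Xf; rewrite -eW.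
- by move=> eW; move: Wf; rewrite eW svoppE; apply: sopp_neq0.
exists (g |: A); split; first exact: indepU1 WC AW Wg.
  by rewrite subUset sub1set in_svzero Xg eqxx.
rewrite cardsU1 cA; case: (boolP (g \in A)) => // /(subsetP AW).
by rewrite in_svzero => /eqP.
Qed.

(** An element of [X^0] off [Z^0] would extend [F] to [r] independent elements inside a
    hyperplane. *)
Lemma cocircuit_unique (F : {set E}) X Z : indep F -> #|F| = r.-1 -> X \in C -> Z \in C ->
  F \subset svzero X -> F \subset svzero Z -> Z = X \/ Z = svopp X.
Proof.
move=> iF cF XC ZC FX FZ.
have [->|/eqP n1] := eqVneq Z X; first by left.
have [->|/eqP n2] := eqVneq Z (svopp X); first by right.
have [g Xg Zg] := cocircuit_outside XC ZC n1 n2.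
have igF := indepU1 iF ZC FZ Zg.
have := indep_vanishing_lt igF XC; rewrite subUset sub1set in_svzero Xg eqxx => /(_ FX).
rewrite cardsU1 cF; case: (boolP (g \in F)) => [/(subsetP FZ)|_].
  by rewrite in_svzero => /eqP.
by have := indep_vanishing_lt iF XC FX; lia.
Qed.

Lemma rank_gt0 X : X \in C -> 0 < r.
Proof. by move=> XC; have := indep_vanishing_lt indep0 XC (sub0set _); case: r. Qed.

Lemma hyperplane_extend X (I : {set E}) : X \in C -> indep I -> I \subset svzero X ->
  exists A, [/\ indep A, I \subset A, A \subset svzero X & #|A| = r.-1].
Proof.
move=> XC iI IX; have r0 := rank_gt0 XC.
have [|B [iB BX cB]] := @hyperplane_indep X r.-1 XC; first by rewrite prednK.
apply: (indep_extend iI iB) => //; last by rewrite cB.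
by have := indep_vanishing_lt iI XC IX; lia.
Qed.

(* An independent set spanning [X^0 :&: Y^0] extends to a basis of the
   hyperplane [X^0] by elements outside [Y^0]. *)
Lemma hyperplane_extend_off X Y (I : {set E}) : X \in C -> indep I ->
  I \subset svzero X :&: svzero Y ->
  (forall W, W \in C -> I \subset svzero W -> svzero X :&: svzero Y \subset svzero W) ->
  exists A, [/\ indep A, I \subset A, A \subset svzero X, #|A| = r.-1 & A :&: svzero Y = I].
Proof.
rewrite subsetI => XC iI /andP[IX IY] hI.
have [A [iA IA AX cA]] := hyperplane_extend XC iI IX.
exists A; split=> //; apply/eqP; rewrite eqEsubset subsetI IA IY !andbT.
apply/subsetP => j; rewrite inE => /andP[jA jY]; apply: contraT => jI.
(* The hyperplane isolating [j] from the rest of [A] contains [I], hence all of the common zero set,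
   [j] included. *)
have [W WC [Wj AW]] := iA j jA.
have IW : I \subset svzero W.
  by apply: subset_trans AW; rewrite subsetD1 IA.
have jG : j \in svzero X :&: svzero Y by rewrite inE (subsetP AX j jA) jY.
by have := subsetP (hI W WC IW) j jG; rewrite in_svzero => /eqP.
Qed.

(** * Distances along a coline *)

Definition dist_le X Y m :=
  exists p : seq sv, [/\ path (coc_adj C r) X p, last X p = Y & size p <= m].

Lemma dist_le_trans X Y W m k : dist_le X Y m -> dist_le Y W k -> dist_le X W (m + k).
Proof.
case=> p [pp <- sp] [q [pq <- sq]]; exists (p ++ q).
by rewrite cat_path pp pq last_cat size_cat leq_add.
Qed.

Lemma dist_leW X Y m k : m <= k -> dist_le X Y m -> dist_le X Y k.
Proof. by move=> le [p [pp lp sp]]; exists p; split=> //; apply: leq_trans le. Qed.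

Lemma dist_le_refl X m : dist_le X X m. Proof. by exists [::]. Qed.

(* Along a common coline the distance is controlled by the separating set:
   eliminating a separating element splits the separating set in two. *)
Lemma coline_dist X Y : X \in C -> Y \in C -> X <> svopp Y ->
  r - 2 <= #|svzero X :&: svzero Y| -> dist_le X Y #|svsep X Y|.+1.
Proof.
have [m] := ubnP #|svsep X Y|; elim: m X Y => // m IH X Y ltm XC YC nXY hc.
have [<-|neXY] := eqVneq X Y; first exact: dist_le_refl.
have [S0|[e eS]] := set_0Vmem (svsep X Y).
  by exists [:: Y]; split=> //=; rewrite /coc_adj XC YC neXY hc S0 eqxx.
move: (eS); rewrite in_svsep => /andP[/eqP Xe /eqP Ye].
have [Z ZC [Ze hZ]] := cocircuit_elim XC YC nXY Xe Ye.
have Ye0 : Y e <> Zero by rewrite Ye; apply: sopp_neq0.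
have Z0 : svzero X :&: svzero Y \subset svzero Z.
  apply/subsetP => f; rewrite inE !in_svzero => /andP[/eqP Xf /eqP Yf].
  by case: (hZ f) => ->; rewrite ?Xf ?Yf.
have sXZ : svsep X Z :|: svsep Z Y \subset svsep X Y :\ e.
  apply/subsetP => f; rewrite !inE; case: (f =P e) => [->|_] /=.
    by rewrite Ze; case: (X e); case: (Y e).
  by case: (hZ f) => ->; case: (X f); case: (Y f).
have dXZ : svsep X Z :&: svsep Z Y = set0.
  apply/setP => f; rewrite !inE.
  by case: (hZ f) => ->; case: (X f); case: (Y f).
have leS : #|svsep X Z| + #|svsep Z Y| < #|svsep X Y|.
  have := subset_leq_card sXZ; rewrite cardsU dXZ cards0 subn0.
  by rewrite [#|svsep X Y|](cardsD1 e) eS add1n.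
(* The loss of [e] from the separating set pays for the second [+1]. *)
apply: (@dist_leW _ _ (#|svsep X Z|.+1 + #|svsep Z Y|.+1)).
  by rewrite addSn addnS ltnS.
apply: (@dist_le_trans _ Z); apply: IH => //.
- by apply: leq_trans (leq_trans _ leS) _; rewrite ?ltnS ?leq_addr.
- by move=> eX; apply: Xe; rewrite eX svoppE Ze.
- by apply: leq_trans hc _; apply: subset_leq_card; rewrite subsetI subsetIl.
- by apply: leq_trans (leq_trans _ leS) _; rewrite ?ltnS ?leq_addl.
- by move=> eZ; apply: Ye0; rewrite -[Y]svoppK -eZ svoppE Ze.
- by apply: leq_trans hc _; apply: subset_leq_card; rewrite subsetI Z0 subsetIr.
Qed.

(** [I] is a basis of the flat [X^0 :&: Y^0], so [r.-1 - #|I|] is the corank [t] of the overview. *)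
Definition common_basis X Y (I : {set E}) : Prop :=
  [/\ indep I, I \subset svzero X :&: svzero Y &
    forall W, W \in C -> I \subset svzero W -> svzero X :&: svzero Y \subset svzero W].

Lemma common_basisC X Y I : common_basis X Y I -> common_basis Y X I.
Proof. by rewrite /common_basis (setIC (svzero Y)). Qed.

Lemma common_basis_extend X Y (I : {set E}) : X \in C -> common_basis X Y I ->
  exists A, [/\ indep A, I \subset A, A \subset svzero X, #|A| = r.-1 & A :&: svzero Y = I].
Proof. by move=> XC [iI IG hI]; apply: hyperplane_extend_off. Qed.

Lemma common_basis_card_diff X Y (I : {set E}) : X \in C -> common_basis X Y I ->
  r.-1 - #|I| <= #|svzero X :\: svzero Y|.
Proof.
move=> XC hI; have [A [iA IA AX <- AY]] := common_basis_extend XC hI.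
rewrite -AY -cardsD; apply: subset_leq_card.
by apply: setSD.
Qed.

(** [X^0] has at least [r.-1] elements and [Y^0] at least [t] more. This is the source of the bound
    [N + 1 - t]. *)
Lemma common_basis_card_outside X Y (I : {set E}) : X \in C -> Y \in C ->
  common_basis X Y I ->
  #|~: (svzero X :|: svzero Y)| + (r.-1 + (r.-1 - #|I|)) <= #|E|.
Proof.
move=> XC YC hI; rewrite -(cardsC (svzero X :|: svzero Y)) addnC leq_add2r.
have := common_basis_card_diff YC (common_basisC hI).
have [A [_ _ AX cA _]] := common_basis_extend XC hI.
have := subset_leq_card AX; rewrite cA.
by rewrite -(cardsID (svzero X) (_ :|: _)) setUK setDUl setDv set0U; apply: leq_add.
Qed.

Lemma svsep_outside (X Y : sv) : svsep X Y \subset ~: (svzero X :|: svzero Y).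
Proof. by apply/subsetP => e; rewrite !inE; case: (X e); case: (Y e). Qed.

Lemma exists_nonzero_common X Y I : X \in C -> Y \in C -> common_basis X Y I -> #|I| < r.-1 ->
  exists2 f, Y f = Zero & X f <> Zero.
Proof.
move=> XC YC hI ltI; have := common_basis_card_diff YC (common_basisC hI).
have [->|[f]] := set_0Vmem (svzero Y :\: svzero X); first by rewrite cards0; lia.
by rewrite !inE => /andP[/eqP Xf /eqP Yf] _; exists f.
Qed.

(* Of all cocircuits on the coline [A :\ e] lying on the side [s] of [X], take
   the first one that meets [Y^0 :\: X^0]. *)
Lemma coline_nearest X Y (A : {set E}) e s f : X \in C -> indep A ->
  A \subset svzero X -> #|A| = r.-1 -> e \in A -> s <> Zero -> Y f = Zero -> X f <> Zero ->
  exists2 Z, Z \in C & [/\ A :\ e \subset svzero Z, Z e = s,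
    (exists2 g, Y g = Zero & X g <> Zero /\ Z g = Zero) &
    forall g, Y g = Zero -> g \notin svsep X Z].
Proof.
move=> XC iA AX cA eA s0 Yf Xf.
have Xe : X e = Zero by apply/eqP; rewrite -in_svzero (subsetP AX).
(* A cocircuit of the coline that vanishes at [e] is [X] or its opposite. *)
have notX (W : sv) g : W \in C -> A :\ e \subset svzero W -> W g = Zero ->
    X g <> Zero -> W e <> Zero.
  move=> WC AW Wg Xg We; have AW' : A \subset svzero W.
    by rewrite -(setD1K eA) subUset sub1set in_svzero We eqxx.
  case: (cocircuit_unique iA cA XC WC AX AW') => eW; apply: Xg.
    by rewrite -eW.
  by rewrite -[X]svoppK -eW svoppE Wg.
pose cand (Z : sv) := [&& Z \in C, A :\ e \subset svzero Z, Z e == s &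
  [exists g, [&& Y g == Zero, X g != Zero & Z g == Zero]]].
have [Z0 Z0P] : exists Z0, cand Z0.
  have [|W WC] := @small_set_cocircuit (f |: (A :\ e)).
    have := rank_gt0 XC; move: cA; rewrite (cardsD1 e) eA cardsU1.
    by case: (f \notin _) => /=; lia.
  rewrite subUset sub1set in_svzero => /andP[/eqP Wf AW].
  have We := notX _ _ WC AW Wf Xf.
  have [eWs|eWs] := sign_eq_or_opp We s0; [exists W|exists (svopp W)].
    rewrite /cand WC AW eWs eqxx /=; apply/existsP; exists f.
    by rewrite Yf Wf eqxx andbT; apply/eqP.
  rewrite /cand cocircuitN // svzero_opp AW svoppE eWs soppK eqxx /=.
  by apply/existsP; exists f; rewrite Yf svoppE Wf eqxx andbT; apply/eqP.
(* Being first on the coline means minimising the separating set from [X]. *)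
have [Z /and4P[ZC AZ /eqP Ze /existsP[h /and3P[/eqP Yh /eqP Xh /eqP Zh]]] minZ] :=
  arg_minnP (fun Z => #|svsep X Z|) Z0P.
exists Z => //; split=> //; first by exists h.
move=> g Yg; apply/negP => gS; move: (gS).
rewrite in_svsep => /andP[/eqP Xg /eqP Zg].
(* If [g] in [Y^0] separates [X] from [Z], eliminating it gives a candidate strictly nearer to
   [X]. *)
have [|W WC [Wg hW]] := cocircuit_elim XC ZC _ Xg Zg.
  by move=> eX; apply: Xh; rewrite eX svoppE Zh.
have AW : A :\ e \subset svzero W.
  apply/subsetP => k kA; rewrite in_svzero.
  have := subsetP AZ k kA; have : k \in svzero X.
    by apply: (subsetP AX); move: kA; rewrite inE => /andP[].
  by rewrite !in_svzero; case: (hW k) => ->.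
have We := notX _ _ WC AW Wg Xg.
have candW : cand W.
  rewrite /cand WC AW /=; apply/andP; split; last first.
    by apply/existsP; exists g; rewrite Yg Wg eqxx andbT; apply/eqP.
  by case: (hW e) => eW; [case: We|case: We; rewrite eW|rewrite eW Ze].
have := minZ W candW; rewrite leqNgt => /negP; apply.
apply/proper_card/properP; split; last first.
  by exists g => //; rewrite in_svsep Wg; case: (X g) Xg.
apply/subsetP => k; rewrite !in_svsep => /andP[Xk /eqP]; rewrite Xk /=.
by case: (hW k) => ->; [case: (X k) Xk|case: (X k) Xk|move=> ->].
Qed.

Lemma exists_approach X Y (I : {set E}) : X \in C -> Y \in C -> common_basis X Y I ->
  #|I| + 2 <= r.-1 ->
  exists Z, [/\ Z \in C, Z <> svopp Y,
    dist_le X Z (#|~: (svzero X :|: svzero Y)|./2).+1 &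
    exists f, [/\ f \notin I, indep (f |: I) & f |: I \subset svzero Z :&: svzero Y]].
Proof.
move=> XC YC hI leI; case: (hI) => iI /[!subsetI]/andP[IX IY] _.
have [A [iA IA AX cA AY]] := common_basis_extend XC hI.
have [f Yf Xf] : exists2 f, Y f = Zero & X f <> Zero.
  by apply: exists_nonzero_common hI _ => //; lia.
have [e eA eI] : exists2 e, e \in A & e \notin I.
  have : 0 < #|A :\: I| by rewrite cardsDS ?subn_gt0 // cA; lia.
  by case/card_gt0P => e; rewrite inE => /andP[]; exists e.
have cAe : #|A :\ e| = r - 2.
  by rewrite subn2 -cA (cardsD1 e A) eA.
(* [j] stays on the coline but is not in [Y^0]; it guarantees [Z <> svopp Y]. *)
have [j jA /andP[je jI]] : exists2 j, j \in A & (j != e) && (j \notin I).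
  have : 0 < #|(A :\: I) :\ e|.
    have := cardsD1 e (A :\: I); rewrite inE eI eA cardsDS // cA; lia.
  by case/card_gt0P => j; rewrite !inE => /and3P[je jI jA]; exists j => //; rewrite je.
have IAe : I \subset A :\ e by rewrite subsetD1 IA.
have Xe : X e = Zero by apply/eqP; rewrite -in_svzero (subsetP AX).
have good s : s <> Zero -> exists2 Z, Z \in C & [/\ A :\ e \subset svzero Z, Z e = s,
    (exists2 g, Y g = Zero & X g <> Zero /\ Z g = Zero) &
    svsep X Z \subset ~: (svzero X :|: svzero Y)].
  move=> s0; have [Z ZC [AZ Ze hg dis]] := coline_nearest XC iA AX cA eA s0 Yf Xf.
  exists Z => //; split=> //; apply/subsetP => g gS; rewrite !inE negb_or.
  move: (gS); rewrite in_svsep => /andP[-> _] /=.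
  by apply/eqP => Yg; have := dis g Yg; rewrite gS.
have [//|Z1 Z1C [AZ1 Z1e [g1 Yg1 [Xg1 Zg1]] S1]] := good Plus.
have [//|Z2 Z2C [AZ2 Z2e [g2 Yg2 [Xg2 Zg2]] S2]] := good Minus.
have finish (Z : sv) g : Z \in C -> A :\ e \subset svzero Z ->
    Y g = Zero -> X g <> Zero -> Z g = Zero ->
    #|svsep X Z| <= #|~: (svzero X :|: svzero Y)|./2 ->
  exists Z, [/\ Z \in C, Z <> svopp Y,
    dist_le X Z (#|~: (svzero X :|: svzero Y)|./2).+1 &
    exists f, [/\ f \notin I, indep (f |: I) & f |: I \subset svzero Z :&: svzero Y]].
  move=> ZC AZ Yg Xg Zg leS; exists Z; split=> //.
  - move=> eZ; move: jI; rewrite -AY inE jA /= => /negP; apply.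
    by rewrite -svzero_opp -eZ (subsetP AZ) // !inE je.
  - apply: (@dist_leW _ _ #|svsep X Z|.+1); first by rewrite ltnS.
    apply: coline_dist => //; first by move=> eX; apply: Xg; rewrite eX svoppE Zg.
    apply: (@leq_trans #|A :\ e|); first by rewrite cAe.
    apply: subset_leq_card; rewrite subsetI AZ andbT.
    by apply: subset_trans AX; apply: subsetDl.
  exists g; split.
  - by apply/negP => /(subsetP IX); rewrite in_svzero => /eqP.
  - exact: indepU1 XC IX Xg.
  by rewrite subsetI !subUset !sub1set !in_svzero Yg Zg eqxx IY (subset_trans IAe AZ).
(* If [k] separates [X] from both, [Z1] and [Z2] agree at [k] and differ at [e]. Eliminating [e]
   then yields the opposite of [X], which forces [g1] in [Y^0] to separate [X] from [Z2]. *)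
have dis : svsep X Z1 :&: svsep X Z2 = set0.
  apply/setP => k; rewrite inE [in RHS]inE !in_svsep.
  apply/negP => /andP[/andP[/eqP Xk /eqP Z1k] /andP[_ /eqP Z2k]].
  have [|||W WC [We hW]] := @cocircuit_elim Z1 Z2 e Z1C Z2C.
  - move=> eZ; move: Z1k; rewrite eZ svoppE Z2k soppK => /esym; exact: sopp_neq.
  - by rewrite Z1e.
  - by rewrite Z1e Z2e.
  have AW : A \subset svzero W.
    apply/subsetP => i iA'; rewrite in_svzero.
    have [->|ie] := eqVneq i e; first by rewrite We.
    have iAe : i \in A :\ e by rewrite !inE ie.
    have := subsetP AZ1 i iAe; have := subsetP AZ2 i iAe; rewrite !in_svzero.
    by case: (hW i) => ->.
  have [eW|eW] := cocircuit_unique iA cA XC WC AX AW.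
    by case: (hW k); rewrite eW ?Z1k ?Z2k; case: (X k) Xk.
  have g1S : g1 \in svsep X Z2.
    rewrite in_svsep; apply/andP; split; first by apply/eqP.
    case: (hW g1); rewrite eW svoppE => h; last by rewrite h.
      by case: (X g1) Xg1 h.
    by move: h; rewrite Zg1; case: (X g1) Xg1.
  by have := subsetP S2 g1 g1S; rewrite !inE Yg1 eqxx orbT.
have le12 : #|svsep X Z1| + #|svsep X Z2| <= #|~: (svzero X :|: svzero Y)|.
  by rewrite -cardsUI dis cards0 addn0; apply: subset_leq_card; rewrite subUset S1.
have [le|gt] := leqP #|svsep X Z1| (#|~: (svzero X :|: svzero Y)|./2).
  exact: (finish Z1 g1).
by apply: (finish Z2 g2) => //; apply: leq_half_of_sum le12 gt.
Qed.

(** * Quadrilaterals *)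

(* With signs read on [p, q, w], three points [(0,+,+)], [(+,0,+)], [(+,+,0)] up
   to reorientation cannot lie on one coline. *)
Lemma no_triangle (K : {set E}) p q w U V W :
  indep (w |: K) -> #|w |: K| = r.-1 -> U \in C -> V \in C -> W \in C ->
  K \subset svzero U -> K \subset svzero V -> K \subset svzero W ->
  U p = Zero -> V q = Zero -> W w = Zero ->
  V p = W p -> U q = W q -> U w = V w ->
  W p <> Zero -> W q <> Zero -> U w <> Zero -> False.
Proof.
move=> iK cK UC VC WC KU KV KW Up Vq Ww Vp Uq Uw Wp0 Wq0 Uw0.
(* The result vanishes on [w |: K], so it is [W] or its opposite; [p] rules out the first and [q]
   the second. *)
have [||Z ZC [Zw hZ]] := cocircuit_elim UC (cocircuitN VC) _ Uw0.
- by rewrite svoppK => eU; apply: Wp0; rewrite -Vp -eU.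
- by rewrite svoppE Uw.
have sub (T : sv) : K \subset svzero T -> T w = Zero -> w |: K \subset svzero T.
  by move=> KT Tw; rewrite subUset sub1set in_svzero Tw eqxx.
have KZ : K \subset svzero Z.
  apply/subsetP => k kK; rewrite in_svzero.
  have := subsetP KU k kK; have := subsetP KV k kK; rewrite !in_svzero.
  by move=> /eqP Vk /eqP Uk; case: (hZ k) => ->; rewrite ?svoppE ?Uk ?Vk.
have [eZ|eZ] := cocircuit_unique iK cK WC ZC (sub _ KW Ww) (sub _ KZ Zw).
  by case: (hZ p); rewrite eZ ?svoppE ?Up ?Vp // => /esym; apply: sopp_neq.
by case: (hZ q); rewrite eZ ?svoppE ?Uq ?Vq; case: (W q) Wq0.
Qed.

(** Contracting [I] leaves rank 3, where elements are pseudolines: [a] and [b] cross at [X], [c] and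
    [d] cross at [Y]. *)
Record quad X Y (I : {set E}) a b c d : Prop := Quad {
  quad_XC : X \in C;
  quad_YC : Y \in C;
  quad_IX : I \subset svzero X;
  quad_IY : I \subset svzero Y;
  quad_Xa : X a = Zero;
  quad_Xb : X b = Zero;
  quad_Yc : Y c = Zero;
  quad_Yd : Y d = Zero;
  quad_Ya : Y a <> Zero;
  quad_Yb : Y b <> Zero;
  quad_Xc : X c <> Zero;
  quad_Xd : X d <> Zero;
  quad_ab : indep (b |: (a |: I));
  quad_cd : indep (d |: (c |: I));
  quad_neab : a != b;
  quad_necd : c != d;
  quad_card : #|I| + 2 = r.-1
}.

Lemma quad_swapl X Y I a b c d : quad X Y I a b c d -> quad X Y I b a c d.
Proof. by case=> *; split=> //; rewrite 1?setUCA // eq_sym. Qed.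

Lemma quad_swapr X Y I a b c d : quad X Y I a b c d -> quad X Y I a b d c.
Proof. by case=> *; split=> //; rewrite 1?setUCA // eq_sym. Qed.

Lemma quad_sym X Y I a b c d : quad X Y I a b c d -> quad Y X I c d a b.
Proof. by case=> *; split. Qed.

Lemma subset_svzeroU1 (T : sv) f (A : {set E}) :
  T f = Zero -> A \subset svzero T -> f |: A \subset svzero T.
Proof. by move=> Tf AT; rewrite subUset sub1set in_svzero Tf eqxx. Qed.

Lemma notin_nonzero (T : sv) f (A : {set E}) : A \subset svzero T -> T f <> Zero -> f \notin A.
Proof. by move=> AT /eqP Tf; apply/negP => /(subsetP AT); rewrite in_svzero (negPf Tf). Qed.

Lemma quad_card_ab X Y I a b c d : quad X Y I a b c d -> #|b |: (a |: I)| = r.-1.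
Proof.
case=> XC YC IX IY Xa Xb Yc Yd Ya Yb Xc Xd iab icd nab ncd cI.
rewrite !cardsU1 in_setU1 negb_or eq_sym nab.
by rewrite (notin_nonzero IY Ya) (notin_nonzero IY Yb) -cI /=; lia.
Qed.

Lemma quad_unique X Y I a b c d Z f : quad X Y I a b c d -> Z \in C -> I \subset svzero Z ->
  Z a = Zero -> Z b = Zero -> Z f = Zero -> X f <> Zero -> False.
Proof.
move=> q ZC IZ Za Zb Zf Xf; case: (q) => XC _ IX _ Xa Xb _ _ _ _ _ _ iab _ _ _ _.
have [||eZ|eZ] := cocircuit_unique iab (quad_card_ab q) XC ZC.
- by do 2 apply: subset_svzeroU1 => //.
- by do 2 apply: subset_svzeroU1 => //.
- by apply: Xf; rewrite -eZ.
- by apply: Xf; rewrite -[X]svoppK -eZ svoppE Zf.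
Qed.

(** The crossing of the lines [a] and [c], with its sign normalised by agreement with [Y] at [b]. *)
Definition corner (Y : sv) (I : {set E}) a b c d P :=
  [/\ P \in C, I \subset svzero P, P a = Zero /\ P c = Zero, P b = Y b & P d <> Zero].

Lemma exists_corner X Y I a b c d : quad X Y I a b c d -> exists P, corner Y I a b c d P.
Proof.
move=> q; case: (q) => XC YC IX IY Xa Xb Yc Yd Ya Yb Xc Xd iab icd nab ncd cI.
have [|P PC] := @small_set_cocircuit (c |: (a |: I)).
  have := rank_gt0 XC; rewrite !cardsU1; case: (_ \notin _); case: (_ \notin _) => /=; lia.
rewrite !subUset !sub1set !in_svzero => /and3P[/eqP Pc /eqP Pa IP].
have Pb : P b <> Zero by move=> Pb; apply: (quad_unique q PC IP Pa Pb Pc).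
have Pd : P d <> Zero by move=> Pd; apply: (quad_unique (quad_sym q) PC IP Pc Pd Pa).
have [ePb|ePb] := sign_eq_or_opp Pb Yb; first by exists P.
exists (svopp P); split; rewrite ?svzero_opp ?svoppE ?Pa ?Pc ?ePb ?soppK //.
  exact: cocircuitN.
exact: sopp_neq0.
Qed.

(** [P], [Q] and the opposite of [X] lie on the coline of [a]; were both signs flipped, they would
    form a forbidden triple. *)
Lemma corner_flip X Y I a b c d P Q : quad X Y I a b c d ->
  corner Y I a b c d P -> corner Y I a b d c Q -> P d = sopp (X d) -> Q c = X c.
Proof.
move=> q [PC IP [Pa Pc] Pb Pd] [QC IQ [Qa Qd] Qb Qc] ePd.
case: (q) => XC YC IX IY Xa Xb Yc Yd Ya Yb Xc Xd iab icd nab ncd cI.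
have [//|eQc] := sign_eq_or_opp Qc Xc; exfalso.
apply: (@no_triangle (a |: I) c d b P Q (svopp X) iab (quad_card_ab q)) => //;
  rewrite ?svzero_opp ?svoppE ?Xb ?Pb ?Qb //; try exact: subset_svzeroU1.
- exact: cocircuitN.
- by rewrite -eQc.
- by rewrite -ePd.
Qed.

(** [P], [T] and [Y] lie on the coline of [c], in the pattern forbidden by [no_triangle]. Hence the
    normalised corners [ac] and [bc] have opposite signs at [d]. *)
Lemma corner_cross X Y I a b c d P T : quad X Y I a b c d ->
  corner Y I a b c d P -> T \in C -> I \subset svzero T -> T b = Zero -> T c = Zero ->
  T a = Y a -> T d = P d -> False.
Proof.
move=> q [PC IP [Pa Pc] Pb Pd] TC IT Tb Tc Ta Td.
case: (q) => XC YC IX IY Xa Xb Yc Yd Ya Yb Xc Xd iab icd nab ncd cI.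
apply: (@no_triangle (c |: I) a b d P T Y icd (quad_card_ab (quad_sym q))) => //;
  exact: subset_svzeroU1.
Qed.

(* An element separating the diagonal [X, Y] from the diagonal [P, R] would cut
   the sides [XP], [XR], [PY] in three points [U1], [U2], [U3] of one coline
   forbidden by [no_triangle]. *)
Lemma diagonals_not_separated X Y I a b c d P R e : quad X Y I a b c d ->
  corner Y I a b c d P -> P d = X d -> corner Y I b a d c R -> R c = X c ->
  X e <> Zero -> Y e = X e -> P e = sopp (X e) -> R e = sopp (X e) -> False.
Proof.
move=> q cP ePd cR eRc Xe Ye Pe Re.
case: (cP) => PC IP [Pa Pc] Pb Pd; case: (cR) => RC IR [Rb Rd] Ra Rc.
case: (q) => XC YC IX IY Xa Xb Yc Yd Ya Yb Xc Xd iab icd nab ncd cI.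
have Pe0 : P e <> Zero by rewrite Pe; apply: sopp_neq0.
have Re0 : R e <> Zero by rewrite Re; apply: sopp_neq0.
have iaI : indep (a |: I) by apply: indepS iab; apply: subsetUr.
have ibI : indep (b |: I) by apply: indepS iab; apply/setUS/subsetUr.
have caI : #|a |: I| = #|I|.+1 by rewrite cardsU1 (notin_nonzero IY Ya).
have cbI : #|b |: I| = #|I|.+1 by rewrite cardsU1 (notin_nonzero IY Yb).
have aX : a |: I \subset svzero X by apply: subset_svzeroU1.
have bX : b |: I \subset svzero X by apply: subset_svzeroU1.
(* Two cocircuits vanishing on [I], [k] and [g] agree up to sign. This keeps the cut points below,
   which vanish at [e], away from the corners, which do not. *)
have uniq k g (T Z : sv) f : indep (k |: I) -> #|k |: I| = #|I|.+1 -> k |: I \subset svzero X ->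
    X g <> Zero -> T \in C -> Z \in C -> I \subset svzero T -> I \subset svzero Z ->
    T k = Zero -> Z k = Zero -> T g = Zero -> Z g = Zero -> Z f = Zero -> T f <> Zero -> False.
  move=> ik ck kX Xg TC ZC IT IZ Tk Zk Tg Zg Zf Tf.
  have cg : #|g |: (k |: I)| = r.-1.
    by rewrite cardsU1 ck (notin_nonzero kX Xg) -cI addn2.
  have [||eZ|eZ] := cocircuit_unique (indepU1 ik XC kX Xg) cg TC ZC.
  - by do 2 apply: subset_svzeroU1 => //.
  - by do 2 apply: subset_svzeroU1 => //.
  - by apply: Tf; rewrite -eZ.
  - by apply: Tf; rewrite -[T]svoppK -eZ svoppE Zf.
have elim (S T : sv) : S \in C -> T \in C -> I \subset svzero S -> I \subset svzero T ->
    S <> svopp T -> S e <> Zero -> T e = sopp (S e) ->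
    exists2 U, U \in C & [/\ I \subset svzero U, U e = Zero &
      forall f, [\/ U f = Zero, U f = S f | U f = T f]].
  move=> SC TC IS IT nST Se Te; have [U UC [Ue hU]] := cocircuit_elim SC TC nST Se Te.
  exists U => //; split=> //; apply/subsetP => k kI; rewrite in_svzero.
  have := subsetP IS k kI; have := subsetP IT k kI; rewrite !in_svzero.
  by case: (hU k) => ->.
have btw (U S T : sv) f : [\/ U f = Zero, U f = S f | U f = T f] -> S f = Zero ->
    U f = Zero \/ U f = T f.
  by case=> -> Sf; [left|left|right].
have btw' (U S T : sv) f : [\/ U f = Zero, U f = S f | U f = T f] -> T f = Zero ->
    U f = Zero \/ U f = S f.
  by case=> -> Tf; [left|right|left].
have btw2 (U S T : sv) f : [\/ U f = Zero, U f = S f | U f = T f] -> T f = S f ->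
    U f = Zero \/ U f = S f.
  by case=> -> Sf; [left|right|right].
have [|U1 U1C [IU1 U1e h1]] := elim X P XC PC IX IP _ Xe Pe.
  by move=> eX; apply: Xc; rewrite eX svoppE Pc.
have U1a : U1 a = Zero by case: (h1 a) => ->.
have U1b : U1 b = Y b.
  have [U1b|->//] := btw _ _ _ _ (h1 b) Xb.
  by case: (quad_unique q U1C IU1 U1a U1b U1e Xe).
have U1c : U1 c = X c.
  have [U1c|//] := btw' _ _ _ _ (h1 c) Pc.
  by case: (uniq a c P U1 e iaI caI aX Xc PC U1C IP IU1 Pa U1a Pc U1c U1e Pe0).
have [|U2 U2C [IU2 U2e h2]] := elim X R XC RC IX IR _ Xe Re.
  by move=> eX; apply: Xd; rewrite eX svoppE Rd.
have U2b : U2 b = Zero by case: (h2 b) => ->.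
have U2a : U2 a = Y a.
  have [U2a|->//] := btw _ _ _ _ (h2 a) Xa.
  by case: (quad_unique q U2C IU2 U2a U2b U2e Xe).
have U2d : U2 d = X d.
  have [U2d|//] := btw' _ _ _ _ (h2 d) Rd.
  by case: (uniq b d R U2 e ibI cbI bX Xd RC U2C IR IU2 Rb U2b Rd U2d U2e Re0).
have U2c : U2 c = X c.
  have [U2c|//] := btw2 _ _ _ _ (h2 c) eRc.
  by case: (corner_cross q cP U2C IU2 U2b U2c U2a); rewrite U2d ePd.
have [||U3 U3C [IU3 U3e h3]] := elim P Y PC YC IP IY _ Pe0.
- by move=> eP; apply: Pd; rewrite eP svoppE Yd.
- by rewrite Pe soppK.
have U3c : U3 c = Zero by case: (h3 c) => ->.
have U3a : U3 a = Y a.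
  have [U3a|//] := btw _ _ _ _ (h3 a) Pa.
  by case: (uniq a c P U3 e iaI caI aX Xc PC U3C IP IU3 Pa U3a Pc U3c U3e Pe0).
have U3d : U3 d = X d.
  rewrite -ePd; have [U3d|//] := btw' _ _ _ _ (h3 d) Yd.
  by case: (quad_unique (quad_sym q) U3C IU3 U3c U3d U3e); rewrite Ye.
have U3b : U3 b = Y b.
  have [U3b|//] := btw2 _ _ _ _ (h3 b) (esym Pb); last by rewrite Pb.
  by case: (corner_cross q cP U3C IU3 U3b U3c U3a); rewrite U3d ePd.
have iae : indep (a |: (e |: I)) by rewrite setUCA; apply: indepU1 iaI XC aX Xe.
have cae : #|a |: (e |: I)| = r.-1.
  by rewrite setUCA cardsU1 caI (notin_nonzero aX Xe) -cI addn2.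
(* On the coline of [e], the points [U2], [U3], [U1] vanish at [b], [c], [a] respectively and
   otherwise agree pairwise. *)
by apply: (@no_triangle (e |: I) b c a U2 U3 U1 iae cae); rewrite ?U1b ?U1c ?U2a ?U3a ?U3b ?U2c //;
  exact: subset_svzeroU1.
Qed.

Lemma card_sum (A : {set E}) : #|A| = \sum_e (e \in A : nat).
Proof. by rewrite -sum1_card big_mkcond; apply: eq_bigr => e _; case: (e \in A). Qed.

(* The two paths [X P Y] and [X R Y] together form the boundary of a
   quadrilateral, which every element crosses at most twice. *)
Lemma quad_dist_corners X Y I a b c d P R : quad X Y I a b c d ->
  corner Y I a b c d P -> P d = X d -> corner Y I b a d c R -> R c = X c ->
  dist_le X Y (#|E| - r).+1.
Proof.
move=> q cP ePd cR eRc.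
case: (cP) => PC IP [Pa Pc] Pb Pd; case: (cR) => RC IR [Rb Rd] Ra Rc.
case: (q) => XC YC IX IY Xa Xb Yc Yd Ya Yb Xc Xd iab icd nab ncd cI.
have abX : b |: (a |: I) \subset svzero X by do 2 apply: subset_svzeroU1 => //.
(* These [r.+1] elements separate no side of the quadrilateral, which leaves [N - 1] elements to
   count. *)
pose D := d |: (c |: (b |: (a |: I))).
have cD : #|D| = r.+1.
  rewrite /D cardsU1 cardsU1 (quad_card_ab q) in_setU1 negb_or eq_sym ncd.
  rewrite (notin_nonzero abX Xc) (notin_nonzero abX Xd) /=.
  by rewrite !add1n prednK ?(rank_gt0 XC).
have count : #|svsep X P| + #|svsep P Y| + (#|svsep X R| + #|svsep R Y|) <= #|~: D| * 2.
  rewrite !card_sum -!big_split /= big_distrl /=; apply: leq_sum => e _.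
  rewrite !in_svsep [e \in ~: D]inE; have [|_] := boolP (e \in D).
    rewrite !in_setU1 => /or4P[/eqP->|/eqP->|/eqP->|/predU1P[->|eI]].
    - by rewrite ePd Yd Rd; case: (X d).
    - by rewrite eRc Yc Pc; case: (X c).
    - by rewrite Pb Xb Rb; case: (Y b).
    - by rewrite Ra Xa Pa; case: (Y a).
    have := subsetP IX e eI; have := subsetP IY e eI; have := subsetP IP e eI.
    have := subsetP IR e eI; rewrite !in_svzero.
    by move=> /eqP-> /eqP-> /eqP-> /eqP->.
  (* More than two crossings around the cycle [X], [P], [Y], [R] require [X] and [Y] to agree at [e]
     and [P] and [R] to be opposite to them. *)
  have := @diagonals_not_separated X Y I a b c d P R e q cP ePd cR eRc.
  case: (X e); case: (Y e); case: (P e); case: (R e) => //= h;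
    by case: h.
have leD := cardsC D; rewrite cD in leD.
have coline k (S T : sv) f : S \in C -> T \in C -> I \subset svzero S -> I \subset svzero T ->
    S k = Zero -> T k = Zero -> k \notin I -> S f <> Zero -> T f = Zero ->
    dist_le S T #|svsep S T|.+1.
  move=> SC TC IS IT Sk Tk kI Sf Tf; apply: coline_dist => //.
    by move=> eS; apply: Sf; rewrite eS svoppE Tf.
  apply: (@leq_trans #|k |: I|); first by rewrite cardsU1 kI subn2 -cI addn2.
  by apply: subset_leq_card; rewrite subsetI !subset_svzeroU1.
have dXP : dist_le X P #|svsep X P|.+1.
  by apply: (coline a _ _ c) => //; apply: notin_nonzero IY Ya.
have dPY : dist_le P Y #|svsep P Y|.+1.
  by apply: (coline c _ _ d) => //; apply: notin_nonzero IX Xc.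
have dXR : dist_le X R #|svsep X R|.+1.
  by apply: (coline b _ _ d) => //; apply: notin_nonzero IY Yb.
have dRY : dist_le R Y #|svsep R Y|.+1.
  by apply: (coline d _ _ c) => //; apply: notin_nonzero IX Xd.
have [le|gt] := leqP (#|svsep X P|.+1 + #|svsep P Y|.+1) (#|E| - r).+1.
  exact: dist_leW le (dist_le_trans dXP dPY).
by apply: dist_leW (dist_le_trans dXR dRY); apply: two_path_arith count leD gt.
Qed.

(** One of the opposite pairs [ac], [bd] or [ad], [bc] has the right signs: [Pac] and [Pbc] differ
    at [d], so exactly one agrees with [X] there, and [corner_flip] provides its partner. *)
Lemma quad_dist X Y I a b c d : quad X Y I a b c d -> dist_le X Y (#|E| - r).+1.
Proof.
move=> q; have [Pac cac] := exists_corner q.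
have [Pad cad] := exists_corner (quad_swapr q).
have [Pbc cbc] := exists_corner (quad_swapl q).
have [Pbd cbd] := exists_corner (quad_swapl (quad_swapr q)).
have neq : Pbc d <> Pac d.
  case: (cbc) => PC IP [Pb Pc] Pa _ e.
  exact: corner_cross q cac PC IP Pb Pc Pa e.
have dac : Pac d <> Zero by case: cac.
have dbc : Pbc d <> Zero by case: cbc.
have [e|e] := sign_eq_or_opp dac (quad_Xd q).
  apply: (quad_dist_corners q cac e cbd); apply: corner_flip (quad_swapl q) cbc cbd _.
  have [e'|//] := sign_eq_or_opp dbc (quad_Xd q).
  by case: neq; rewrite e.
apply: (quad_dist_corners (quad_swapr q) cad _ cbc).
  exact: corner_flip q cac cad e.
have [//|e'] := sign_eq_or_opp dbc (quad_Xd q).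
by case: neq; rewrite e.
Qed.

(** * The distance bound *)

Definition diam_bound N t := N.+1 + \sum_(2 <= k < t) ((N - k)./2).+1.

Lemma diam_boundS N t : 2 <= t -> diam_bound N t.+1 = diam_bound N t + ((N - t)./2).+1.
Proof. by move=> t2; rewrite /diam_bound big_nat_recr //= addnA. Qed.

Lemma diam_bound_mono N : {homo diam_bound N : s t / s <= t}.
Proof.
move=> s t st; rewrite leq_add2l.
have [s2|s2] := leqP s 2; first by rewrite big_geq.
by rewrite (@big_cat_nat _ _ _ s 2 t) ?leq_addr //; apply: ltnW.
Qed.

Lemma common_basis_pair (X Y : sv) (I : {set E}) :
  X \in C -> common_basis X Y I -> #|I| + 2 = r.-1 ->
  exists (a b : E), [/\ X a = Zero /\ X b = Zero, Y a <> Zero /\ Y b <> Zero,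
    indep (b |: (a |: I)) & a != b].
Proof.
move=> XC hI cI; have [A [iA IA AX cA AY]] := common_basis_extend XC hI.
have cAI : #|A :\: I| == 2 by rewrite cardsDS // cA -cI addKn.
have /cards2P[a [b [nab eAI]]] := cAI.
have off k : k \in A :\: I -> X k = Zero /\ Y k <> Zero.
  rewrite inE => /andP[kI kA]; split.
    by apply/eqP; rewrite -in_svzero (subsetP AX).
  by move=> Yk; move: kI; rewrite -AY inE kA in_svzero Yk eqxx.
have [|Xa Ya] := off a; first by rewrite eAI !inE eqxx.
have [|Xb Yb] := off b; first by rewrite eAI !inE eqxx orbT.
exists a, b; split=> //; suff -> : b |: (a |: I) = A by [].
by rewrite -[RHS](setID A I) (setIidPr IA) eAI setUCA setUA setUC.
Qed.

(** [I] is only required to be independent: after an approach step, [f |: I] need not span the new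
    common flat. It is first completed to a basis, which can only lower the corank. *)
Lemma cocircuit_dist t X Y (I : {set E}) : X \in C -> Y \in C -> X <> svopp Y ->
  indep I -> I \subset svzero X :&: svzero Y -> r.-1 - #|I| <= t ->
  dist_le X Y (diam_bound (#|E| - r) t).
Proof.
have [m] := ubnP t; elim: m t X I => // m IH t X I ltm XC YC nXY iI IG leI.
have [I' [iI' sI' I'G hI']] := indep_maximal iI IG.
have hI : common_basis X Y I' by [].
have leI' : r.-1 - #|I'| <= t.
  by apply: leq_trans leI; apply/leq_sub2l/subset_leq_card.
apply: dist_leW (diam_bound_mono _ leI') _.
have /[!subsetI]/andP[I'X I'Y] := I'G.
have r0 := rank_gt0 XC.
have ltI' := indep_vanishing_lt iI' XC I'X.
have := common_basis_card_outside XC YC hI.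
have : #|I'| + (r.-1 - #|I'|) = r.-1 by rewrite subnKC // -ltnS prednK.
(* Corank 0 gives equality, 1 a common coline, 2 a quadrilateral, and [s.+3] an approach step. *)
case: (r.-1 - #|I'|) leI' => [|[|[|s]]] leI' cI' out.
- have [|->|eY] := cocircuit_unique iI' _ XC YC I'X I'Y; first by rewrite -cI' addn0.
    exact: dist_le_refl.
  by case: nXY; rewrite eY svoppK.
- apply: (@dist_leW _ _ #|svsep X Y|.+1).
    rewrite /diam_bound big_geq // addn0 ltnS.
    apply: leq_trans (subset_leq_card (svsep_outside X Y)) _.
    by have := leq_sub2r r out; rewrite addn1 prednK // addnK.
  apply: coline_dist => //; apply: (@leq_trans #|I'|); last exact: subset_leq_card.
  by rewrite subn2 -cI' addn1.
- have [a [b [[Xa Xb] [Ya Yb] iab nab]]] := common_basis_pair XC hI cI'.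
  have [c [d [[Yc Yd] [Xc Xd] icd ncd]]] := common_basis_pair YC (common_basisC hI) cI'.
  rewrite /diam_bound big_geq // addn0.
  by apply: (@quad_dist X Y I' a b c d).
have [|Z [ZC nZY dXZ [f [fI ifI fIG]]]] := exists_approach XC YC hI.
  by rewrite -cI' leq_add2l.
(* With corank [t = s.+3], the approach costs the summand of index [k = t - 1]. *)
rewrite diam_boundS // addnC; apply: (@dist_le_trans _ Z).
  apply: dist_leW dXZ; rewrite ltnS half_leq //.
  exact: outside_arith out.
apply: IH ifI fIG _ => //; first exact: leq_trans leI' _.
by rewrite cardsU1 fI -cI' add1n addnS subSS addKn.
Qed.

Lemma common_basis_exists X Y : exists I, common_basis X Y I.
Proof.
have [I [iI _ IG hI]] := indep_maximal indep0 (sub0set (svzero X :&: svzero Y)).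
by exists I.
Qed.

Lemma hyperplane_card X : X \in C -> r.-1 <= #|svzero X|.
Proof.
move=> XC; have [|A [_ AX <-]] := @hyperplane_indep X r.-1 XC.
  by rewrite prednK ?(rank_gt0 XC).
exact: subset_leq_card.
Qed.

Lemma card_zero_diff X Y : Y \in C -> #|svzero X :\: svzero Y| <= (#|E| - r).+1.
Proof.
move=> YC; have h := hyperplane_card YC; have r0 := rank_gt0 YC.
have : #|svzero X :\: svzero Y| <= #|~: svzero Y|.
  by apply: subset_leq_card; rewrite setDE subsetIr.
by have := cardsC (svzero Y); apply: diff_arith h r0.
Qed.

Lemma cocircuit_dist_diff X Y : X \in C -> Y \in C -> X <> svopp Y ->
  dist_le X Y (diam_bound (#|E| - r) #|svzero X :\: svzero Y|).
Proof.
move=> XC YC nXY; have [I hI] := common_basis_exists X Y; case: (hI) => iI IG _.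
exact: (cocircuit_dist XC YC nXY iI IG (common_basis_card_diff XC hI)).
Qed.

(** The corank is at most [r.-1], and also at most [#|X^0 :\: Y^0|], hence at most [N + 1]. *)
Lemma cocircuit_dist_rank X Y : X \in C -> Y \in C -> X <> svopp Y ->
  dist_le X Y (diam_bound (#|E| - r) (minn r.-1 (#|E| - r).+1)).
Proof.
move=> XC YC nXY; have [I hI] := common_basis_exists X Y; case: (hI) => iI IG _.
apply: (cocircuit_dist XC YC nXY iI IG); rewrite leq_min leq_subr.
exact: leq_trans (common_basis_card_diff XC hI) (card_zero_diff X YC).
Qed.

(** Pass through a point [W] of a coline in [X^0] with [W f = Zero]. The two separating sets are
    disjoint and avoid [f] and [X^0], that is, at least [r] elements. *)
Lemma antipodal_dist X : X \in C -> 2 <= r -> dist_le X (svopp X) (#|E| - r).+2.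
Proof.
move=> XC r2; have [|F [iF FX cF]] := @hyperplane_indep X (r - 2) XC; first by lia.
have [f Xf] := cocircuit_neq0 XC; have fX : f \notin svzero X by rewrite in_svzero; apply/eqP.
have [|W WC] := @small_set_cocircuit (f |: F).
  by rewrite cardsU1 cF; case: (_ \notin _) => /=; lia.
rewrite subUset sub1set in_svzero => /andP[/eqP Wf FW].
have out : #|svsep X W| + #|svsep W (svopp X)| + r <= #|E|.
  rewrite -(cardsC (f |: svzero X)) addnC leq_add //.
    by have := hyperplane_card XC; rewrite cardsU1 fX add1n; have := rank_gt0 XC; case: r.
  rewrite -cardsUI; suff -> : svsep X W :&: svsep W (svopp X) = set0.
    rewrite cards0 addn0; apply: subset_leq_card; apply/subsetP => e.
    rewrite inE !in_svsep !inE negb_or svoppE; case: (e =P f) => [->|_] /=.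
      by rewrite Wf; case: (X f) Xf.
    by case: (X e); case: (W e).
  by apply/setP => e; rewrite inE !in_svsep !inE svoppE; case: (X e); case: (W e).
apply: (@dist_leW _ _ (#|svsep X W|.+1 + #|svsep W (svopp X)|.+1)).
  exact: antipodal_arith out.
have hF T : F \subset svzero T -> F \subset svzero (svopp T) by rewrite svzero_opp.
apply: (@dist_le_trans _ W); apply: coline_dist => //.
- by move=> eX; apply: Xf; rewrite eX svoppE Wf.
- by rewrite -cF; apply: subset_leq_card; rewrite subsetI FX.
- exact: cocircuitN.
- by rewrite svoppK => eW; apply: Xf; rewrite -eW.
- by rewrite -cF; apply: subset_leq_card; rewrite subsetI FW hF.
Qed.

Lemma cocircuit_diam X Y : X \in C -> Y \in C -> 4 <= r -> 2 <= #|E| - r ->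
  dist_le X Y (diam_bound (#|E| - r) (minn (r - 2) (#|E| - r)).+1).
Proof.
move=> XC YC r4 n2; have [->|/eqP nXY] := eqVneq X (svopp Y).
  rewrite -{2}[Y]svoppK; apply: dist_leW (antipodal_dist (cocircuitN YC) _); last by lia.
  (* The term [k = 2] covers the extra antipodal step; it is present because [r >= 4] and
     [N >= 2]. *)
  apply: (@leq_trans (diam_bound (#|E| - r) 3)).
    by rewrite diam_boundS // /diam_bound big_geq // addn0 addnS !ltnS leq_addr.
  by apply: diam_bound_mono; rewrite ltnS leq_min n2 andbT; lia.
suff -> : (minn (r - 2) (#|E| - r)).+1 = minn r.-1 (#|E| - r).+1.
  exact: cocircuit_dist_rank.
by rewrite -minnSS -subSn ?(ltnW (ltnW r4)) // subSS subn1.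
Qed.

End OrientedMatroid.

(** * Transfer of the bound to the integers *)

Local Open Scope ring_scope.

(** The condition on [t] keeps every index [k] at most [n - r], where truncated and integer
    subtraction agree. *)
Lemma diam_boundZ n r t : (r <= n)%N -> (t <= (n - r).+1)%N ->
  (diam_bound (n - r) t)%:Z =
  n%:Z - r%:Z + 1 + \sum_(2 <= k < t) (((n%:Z - r%:Z - k%:Z) %/ 2)%Z + 1).
Proof.
move=> rn tn; rewrite /diam_bound PoszD -addn1 PoszD -subzn //; congr (_ + _).
rewrite (big_morph Posz PoszD (erefl 0%:Z)) !big_nat; apply: eq_bigr => k /andP[_ kt].
have kN : (k <= n - r)%N by rewrite -ltnS; apply: leq_trans kt tn.
rewrite !subzn // -addn1 PoszD; congr (_ + _).
by rewrite -divn2 -divz_nat.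
Qed.

Lemma dist_leP (E : finType) (C : {set {ffun E -> sign}}) r X Y m (M : int) :
  dist_le C r X Y m -> m%:Z = M -> coc_dist_le C r X Y M.
Proof. by case=> p [pp lp sp] <-; exists p. Qed.

Theorem theorem1p8 (E : finType) (C : {set {ffun E -> sign}}) (r : nat) :
  is_oriented_matroid C -> has_rank C r ->
  (forall X Y, X \in C -> Y \in C -> X != svopp Y ->
     coc_dist_le C r X Y
       (#|E|%:Z - r%:Z + 1 +
        \sum_(2 <= k < #|svzero X :\: svzero Y|)
           (((#|E|%:Z - r%:Z - k%:Z) %/ 2)%Z + 1))) /\
  ((4 <= r)%N -> (2 <= #|E| - r)%N ->
     coc_diam_le C r
       (#|E|%:Z - r%:Z + 1 +
        \sum_(2 <= k < (minn (r - 2) (#|E| - r)).+1)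
           (((#|E|%:Z - r%:Z - k%:Z) %/ 2)%Z + 1))).
Proof.
move=> OM rankC; have rE : (r <= #|E|)%N.
  by have [B [_ <-]] := exists_basis OM rankC; apply: max_card.
split=> [X Y XC YC /eqP nXY|r4 n2 X Y XC YC].
  apply: dist_leP (cocircuit_dist_diff OM rankC XC YC nXY) _.
  by apply: diam_boundZ => //; apply: (card_zero_diff OM rankC _ YC).
apply: dist_leP (cocircuit_diam OM rankC XC YC r4 n2) _.
by apply: diam_boundZ => //; rewrite ltnS geq_minr.
Qed.
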